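(* Let $T,S,X\in M_n(\mathbb{C})$ be such that $T$ and $S$ are positive semi-definite, let $p,q>1$ with $\frac1p+\frac1q=1$, let $m\in\mathbb{N}$, and let $|||\cdot|||$ be any unitarily invariant norm on $M_n(\mathbb{C})$. Then for all $r\ge1$ $$|||T^{\frac1p}XS^{\frac1q}|||^m+r_0^m\left(|||TX|||^{\frac m2}-|||XS|||^{\frac m2}\right)^2\le\left(\frac1p|||TX|||^{r}+\frac1q|||XS|||^{r}\right)^{\frac mr},$$ where $r_0=\min\left\{\frac1p,\frac1q\right\}$.
   Context: $M_n(\mathbb{C})$ is the algebra of $n\times n$ complex matrices. A norm $|||\cdot|||$ on $M_n(\mathbb{C})$ is unitarily invariant if $|||UAV|||=|||A|||$ for all $A\in M_n(\mathbb{C})$ and all unitary $U,V\in M_n(\mathbb{C})$. *)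

(* Defs.v *)
From mathcomp Require Export all_boot all_order all_algebra.
From mathcomp Require Export sesquilinear spectral.
From mathcomp Require Export complex.
From mathcomp Require Export reals exp.

Set Implicit Arguments.
Unset Strict Implicit.
Unset Printing Implicit Defensive.

Import Order.TTheory GRing.Theory Num.Theory.
Local Open Scope ring_scope.
Local Open Scope sesquilinear_scope.
Local Open Scope complex_scope.

(* In the order of [R[i]], [0 <= z] means that [z] is real and nonnegative. *)
Definition psdmx (R : realType) (n : nat) (A : 'M[R[i]]_n) : Prop :=
  A \is hermsymmx /\ forall v : 'cV[R[i]]_n, 0 <= (v ^t* *m A *m v) 0 0.

(* Functional calculus: if [A = P^-1 D P] with [P] unitary and [D] diagonal,
   then [mxpowR A s = P^-1 D^s P]; the result does not depend on the chosen
   diagonalization.  The entries of [D] are complex numbers; when [A] is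
   positive semi-definite they are nonnegative reals, so that taking their real
   part loses nothing.  Meaningful for positive semi-definite [A] only. *)
Definition mxpowR (R : realType) (n : nat) (A : 'M[R[i]]_n) (s : R) :
    'M[R[i]]_n :=
  invmx (spectralmx A)
  *m diag_mx (map_mx (fun z : R[i] => (powR (complex.Re z) s)%:C)
                     (spectral_diag A))
  *m spectralmx A.

(* Complex matrices already carry a canonical norm in the library (the max
   norm), hence norms are represented here by plain functions. *)
Record is_mxnorm (R : realType) (n : nat) (N : 'M[R[i]]_n -> R) : Prop :=
  IsMxNorm {
    mxnorm_ge0 : forall A, 0 <= N A;
    mxnorm_eq0 : forall A, N A = 0 -> A = 0;
    mxnormZ : forall (c : R[i]) A, (N (c *: A))%:C = `|c| * (N A)%:C;
    mxnormD : forall A B, N (A + B) <= N A + N B }.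

Definition unitarily_invariant (R : realType) (n : nat)
    (N : 'M[R[i]]_n -> R) : Prop :=
  forall A U V : 'M[R[i]]_n, U \is unitarymx -> V \is unitarymx ->
    N (U *m A *m V) = N A.

(* Main.v *)
Require Import Defs.
From mathcomp Require Import ring lra.
From mathcomp Require Import boolp classical_sets functions set_interval.
From mathcomp Require Import interval_inference topology normedtype sequences.
From mathcomp Require Import derive realfun trigo convex hoelder.

(** The heart of the matter is the interpolation inequality
    [N (T^l X S^u) <= N (T X)^l * N (X S)^u] for [l + u = 1]
    ([mxnorm_mxpowR_le]); the theorem then follows from two inequalities
    between nonnegative reals, applied to [a = N (T X)] and [b = N (X S)]: a
    refinement of Young's inequality, [refined_young], and the monotonicity of
    power means, [power_mean_le].

    Interpolation. Diagonalizing [T] and [S] and using unitary invariance, the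
    matrix [T^l X S^u] is replaced by the one with entries
    [a_i^l b_j^u Y_ij], where [a] and [b] are the spectra.  Zero eigenvalues
    are removed by compressing to the nonzero ones, which does not increase the
    norm because a compression is an average of sign changes.  One is left with
    [f s = N (e^(s x_i + (1 - s) y_j) Z_ij)], and must show that [f] is convex
    (then shifting [x] by a constant turns the bound by the chord into the
    geometric one).  This is a discrete form of the three lines theorem.  The
    matrix inside [N] is an entire function of [s], so that it is, up to
    [o(h^2)], the average of its values at [s + h], [s - h], [s + ih] and
    [s - ih]; moving by [ih] multiplies by unitary diagonal matrices on both
    sides, hence leaves the norm unchanged.  Therefore
    [2 f s <= f (s + h) + f (s - h) + o(h^2)], which for a continuous function
    implies convexity by a maximum principle
    ([chord_of_second_difference]).

    Refined Young inequality. Expand [(l a + u b)^m] by the binomial theorem.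
    When [u <= l], the coefficients of [a^m] and [b^m] are at least [u^m], so
    [u^m (a^m + b^m - 2 (ab)^(m/2))] may be subtracted while keeping positive
    coefficients. These sum to 1 and the mean exponents of [a] and [b] are still
    [m l] and [m u], so the weighted inequality between arithmetic and
    geometric means bounds the remainder below by [(a^l b^u)^m]. *)

Set Implicit Arguments.
Unset Strict Implicit.
Unset Printing Implicit Defensive.

Import Order.TTheory GRing.Theory Num.Theory.
Local Open Scope ring_scope.
Local Open Scope complex_scope.

(** * Two inequalities between weighted means *)

Lemma binomial_weights_sum (F : comPzRingType) (l u : F) (m : nat) :
  l + u = 1 -> \sum_(k < m.+1) (l ^+ (m - k) * u ^+ k *+ 'C(m, k)) = 1.
Proof. by move=> lu; rewrite -exprDn lu expr1n. Qed.

(** The mean of the binomial law of parameters [m] and [u]. *)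
Lemma binomial_weights_mean (F : comPzRingType) (l u : F) (m : nat) :
  l + u = 1 ->
  \sum_(k < m.+1) (l ^+ (m - k) * u ^+ k *+ 'C(m, k)) * k%:R = m%:R * u.
Proof.
move=> lu; case: m => [|m]; first by rewrite big_ord1 mulr0 mul0r.
rewrite big_ord_recl /= mulr0 add0r.
rewrite -[RHS]mulr1 -[X in _ = _ * X](binomial_weights_sum m lu).
rewrite big_distrr; apply: eq_bigr => k _.
rewrite /bump /= add1n subSS -(mulr_natr (_ * _)) -mulrA -natrM mulnC.
by rewrite -mul_bin_diag natrM exprS -(mulr_natr (_ * _)); ring.
Qed.

Section scalar.
Variable R : realType.
Implicit Types a b l u r A B t : R.

Lemma expR_ge_tangent t0 t : expR t0 * (1 + (t - t0)) <= expR t.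
Proof.
have -> : expR t = expR t0 * expR (t - t0) by rewrite -expRD subrKC.
by rewrite ler_wpM2l ?expR_ge0// expR_ge1Dx.
Qed.

(** [phi k] below is the gap between the [k]-th monomial and its tangent at
    the weighted mean [m (l A + u B)] of the exponents.  The binomial weights
    average the tangents to the constant [G], so the two sides differ by an
    average of gaps, from which only [k = 0] and [k = m] are kept, each with
    weight [u^m]; one more tangent inequality disposes of the cross term. *)
Lemma refined_young_exp A B l u (M : nat) :
  (0 < M)%N -> 0 < u -> u <= l -> l + u = 1 ->
  expR (l * A + u * B) ^+ M
    + u ^+ M * (expR (M%:R / 2 * A) - expR (M%:R / 2 * B)) ^+ 2
  <= (l * expR A + u * expR B) ^+ M.
Proof.
move=> M0 u0 ul lu; have l0 : 0 < l by apply: lt_le_trans ul.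
have lu1 : l = 1 - u by rewrite -lu addrK.
(* [G] is the target [(a^l b^u)^m], with [a = e^A] and [b = e^B]. *)
pose G := expR (M%:R * (l * A + u * B)).
pose tau (k : nat) := (k%:R - M%:R * u) * (B - A).
pose c (k : nat) := l ^+ (M - k) * u ^+ k *+ 'C(M, k).
pose phi (k : nat) := expR ((M%:R - k%:R) * A + k%:R * B) - G * (1 + tau k).
have phi_ge0 k : 0 <= phi k.
  rewrite subr_ge0.
  apply: le_trans (expR_ge_tangent (M%:R * (l * A + u * B)) _).
  rewrite le_eqVlt; apply/orP; left; apply/eqP; rewrite /tau.
  by rewrite /G lu1; congr (_ * _); ring.
have c_ge0 k : 0 <= c k by rewrite mulrn_wge0// mulr_ge0// exprn_ge0// ltW.
have expand : (l * expR A + u * expR B) ^+ M - G = \sum_(k < M.+1) c k * phi k.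
  rewrite exprDn; under [RHS]eq_bigr do rewrite mulrBr.
  rewrite sumrB; congr (_ - _).
    apply: eq_bigr => k _; rewrite /c !exprMn expRD -natrB ?(leq_ord k)//.
    by rewrite !expRM_natl mulrACA mulrnAl.
  have term k : c k * (G * (1 + tau k))
      = G * (c k + (c k * k%:R - c k * (M%:R * u)) * (B - A)).
    by rewrite /tau; ring.
  under eq_bigr do rewrite term.
  rewrite -big_distrr big_split -big_distrl sumrB -big_distrl /=.
  rewrite (binomial_weights_sum _ lu) (binomial_weights_mean _ lu).
  by rewrite mul1r subrr mul0r addr0 mulr1.
have ends : u ^+ M * phi 0 + u ^+ M * phi M <= \sum_(k < M.+1) c k * phi k.
  rewrite (bigD1 ord0)//= (bigD1 ord_max) -?val_eqE/= -?lt0n// addrA.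
  apply: ler_wpDr; first by apply: sumr_ge0 => i _; apply: mulr_ge0.
  apply: lerD; apply: ler_wpM2r => //; rewrite /c.
    by rewrite subn0 bin0 expr0 mulr1 lerXn2r// nnegrE ltW.
  by rewrite subnn binn expr0 mul1r.
have mid := expR_ge_tangent (M%:R * (l * A + u * B)) (M%:R / 2 * (A + B)).
have sq : (expR (M%:R / 2 * A) - expR (M%:R / 2 * B)) ^+ 2
    = expR (M%:R * A) + expR (M%:R * B) - 2 * expR (M%:R / 2 * (A + B)).
  have h (C : R) : expR (M%:R * C) = expR (M%:R / 2 * C) ^+ 2.
    by rewrite -expRM_natl; congr expR; field.
  by rewrite !h mulrDr expRD; ring.
rewrite -expRM_natl -/G -lerBrDl expand; apply: le_trans ends.
rewrite -mulrDr ler_wpM2l ?exprn_ge0 ?(ltW u0)// sq /phi /tau.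
move: mid; rewrite -/G.
rewrite lu1 subr0 mul0r addr0 subrr mul0r !add0r.
set em := expR (_ / _ * _); set ea := expR (_ * A); set eb := expR (_ * B).
move=> mid; rewrite -subr_ge0 [leRHS](_ : _ = 2 * (em - G * (1
  + (M%:R / 2 * (A + B) - M%:R * ((1 - u) * A + u * B))))); last by field.
by rewrite mulr_ge0// subr_ge0.
Qed.

(** Zero is not in the range of [expR], so [a = 0] and [b = 0] need their own
    argument; there the geometric mean vanishes. *)
Lemma refined_young_le a b l u (m : nat) :
  0 <= a -> 0 <= b -> 0 < u -> u <= l -> l + u = 1 ->
  (a `^ l * b `^ u) ^+ m
    + u ^+ m * (a `^ (m%:R / 2) - b `^ (m%:R / 2)) ^+ 2
  <= (l * a + u * b) ^+ m.
Proof.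
move=> a0 b0 u0 ul lu; have l0 : 0 < l by apply: lt_le_trans ul.
case: m => [|m].
  by rewrite !expr0 mul0r !powRr0 subrr expr0n /= mulr0 addr0.
have half (c : R) : 0 <= c -> (c `^ (m.+1%:R / 2)) ^+ 2 = c ^+ m.+1.
  move=> c0; rewrite -powR_mulrn ?powR_ge0// -powRrM divfK ?pnatr_eq0//.
  by rewrite powR_mulrn.
have m2 : m.+1%:R / 2 != 0 :> R by rewrite mulf_neq0 ?invr_eq0 ?pnatr_eq0.
move: a0 b0; rewrite le_eqVlt => /predU1P[<- b0|a0].
  rewrite (powR0 (lt0r_neq0 l0)) mul0r expr0n /= add0r (powR0 m2) sub0r.
  by rewrite sqrrN half// mulr0 add0r exprMn.
rewrite le_eqVlt => /predU1P[<-|b0].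
  rewrite (powR0 (lt0r_neq0 u0)) mulr0 expr0n /= add0r (powR0 m2) subr0.
  rewrite half ?(ltW a0)// mulr0 addr0 exprMn ler_wpM2r ?exprn_ge0 ?(ltW a0)//.
  by rewrite lerXn2r// nnegrE ltW.
rewrite /powR !gt_eqF// -expRD.
have := @refined_young_exp (ln a) (ln b) l u m.+1 isT u0 ul lu.
by rewrite !lnK// posrE.
Qed.

Lemma refined_young a b l u (m : nat) :
  0 <= a -> 0 <= b -> 0 < l -> 0 < u -> l + u = 1 ->
  (a `^ l * b `^ u) ^+ m
    + Num.min l u ^+ m * (a `^ (m%:R / 2) - b `^ (m%:R / 2)) ^+ 2
  <= (l * a + u * b) ^+ m.
Proof.
move=> a0 b0 l0 u0 lu; have [lu'|ul] := leP l u; last first.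
  exact: refined_young_le (ltW ul) lu.
rewrite mulrC -sqrrN opprB [l * a + _]addrC.
by apply: refined_young_le; rewrite // addrC.
Qed.

(** Jensen's inequality for the convex function [x `^ r]. *)
Lemma power_mean_le a b l u r :
  0 <= a -> 0 <= b -> 0 <= l -> 0 <= u -> l + u = 1 -> 1 <= r ->
  l * a + u * b <= (l * a `^ r + u * b `^ r) `^ r^-1.
Proof.
move=> a0 b0 l0 u0 lu r1; have r0 : 0 < r by apply: lt_le_trans r1.
have l1 : l <= 1 by rewrite -lu lerDl.
have ul : u = 1 - l by rewrite -lu addrAC subrr add0r.
have := convex_powR r1 (Itv01 l0 l1).
move=> /(_ a b); rewrite !inE /= !in_itv /= a0 b0 => /(_ isT isT).
rewrite convRE [X in X `^ _ <= _]convRE /= /unstable.onem -ul => cvx.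
have s0 : 0 <= l * a + u * b by rewrite addr_ge0 ?mulr_ge0.
rewrite -[leLHS](powRr1 s0) -(mulfV (lt0r_neq0 r0)) powRrM.
apply: ge0_ler_powR; rewrite ?invr_ge0 ?(ltW r0) ?nnegrE ?powR_ge0//.
by rewrite addr_ge0// mulr_ge0// powR_ge0.
Qed.
End scalar.

(** * Convexity from second differences *)

Section analysis.
Import numFieldTopology.Exports numFieldNormedType.Exports.
Local Open Scope classical_set_scope.
Variable R : realType.

(** The sum over the fourth roots of unity [w] of [e^(w t) - 1]: the terms of
    degree 1, 2 and 3 of the power series cancel. *)
Definition fourth_diff (t : R) : R := expR t + expR (- t) + 2 * cos t - 4.

Lemma is_derive_quotient (f : R -> R) (df : R) :
  is_derive (0 : R) 1 f df -> f 0 = 0 -> f h / h @[h --> 0^'] --> df.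
Proof.
move=> [dr <-] f0.
have -> : (fun h => f h / h)
    = (fun h => h^-1 *: ((f \o shift 0) (h *: (1 : R)) - f 0)).
  apply/funext => h; rewrite f0 subr0 /= addr0.
  by rewrite /GRing.scale /= mulr1 mulrC.
exact: dr.
Qed.

(** With [w = t / 2], [fourth_diff (h t)] factors as
    [(2 sinh (h w) - 2 sin (h w)) (2 sinh (h w) + 2 sin (h w))]; after division
    by [h], the first factor tends to 0 and the second one stays bounded. *)
Lemma fourth_diff_littleo (t : R) :
  (fun h : R => fourth_diff (h * t) / h ^+ 2) @ 0^' --> (0 : R).
Proof.
pose w := t / 2.
pose phi (c h : R) := expR (h * w) - expR (- (h * w)) + c * sin (h * w).
have fac h : fourth_diff (h * t) = phi (- 2) h * phi 2 h.
  have -> : h * t = h * w + h * w by rewrite /w; field.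
  rewrite /fourth_diff /phi opprD !expRD cosD.
  have e1 : expR (h * w) * expR (- (h * w)) = 1 by rewrite -expRD subrr expR0.
  have e2 := cos2sin2 (h * w); rewrite expr2 in e2; rewrite e2.
  set x := expR (h * w) in e1 *; set y := expR _ in e1 *.
  have -> : (x - y + -2 * sin (h * w)) * (x - y + 2 * sin (h * w))
    = x * x + y * y - 2 * (x * y) - 4 * sin (h * w) ^+ 2 by ring.
  by rewrite e1; ring.
have dphi c : phi c h / h @[h --> 0^'] --> 2 * w + c * w.
  apply: is_derive_quotient; last first.
    by rewrite /phi !mul0r oppr0 expR0 sin0 subrr mulr0 addr0.
  have -> : phi c = (expR \o (w \*: id) : R -> R)
      - (expR \o (- w \*: id) : R -> R) + c \*: (@sin R \o (w \*: id) : R -> R).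
    apply/funext => h /=.
    by rewrite /phi !fctE /= /GRing.scale /= mulNr !(mulrC w).
  apply: is_derive_eq.
  rewrite /= /GRing.scale /= !mulr0 expR0 cos0; ring.
have -> : (fun h => fourth_diff (h * t) / h ^+ 2)
  = (fun h => (phi (-2) h / h) * (phi 2 h / h)).
  by apply/funext => h; rewrite fac expr2 invfM; ring.
have e0 : (2 * w + (-2) * w) * (2 * w + 2 * w) = 0 :> R by ring.
rewrite -[X in _ --> X]e0; apply: cvgM; exact: dphi.
Qed.

(** Subtracting the chord and [e t (1 - t)] makes the second differences
    strictly positive, so that the maximum over [[0, 1]] cannot be attained in
    the interior. *)
Lemma chord_of_second_difference (f : R -> R) :
  continuous f ->
  (forall s e : R, 0 < e ->
    \forall h \near 0^'+, 2 * f s - e * h ^+ 2 <= f (s + h) + f (s - h)) ->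
  forall s : R, 0 <= s <= 1 -> f s <= s * f 1 + (1 - s) * f 0.
Proof.
move=> cf f2 s s01; apply/ler_addgt0Pr => e e0.
pose g (t : R) := f t - (t * f 1 + (1 - t) * f 0) - e * (t * (1 - t)).
have cg : {within `[0, 1], continuous g}.
  apply: continuous_subspaceT => t; rewrite /g.
  apply: cvgB; first apply: cvgB; first exact: cf.
    apply: cvgD; apply: cvgM; (try apply: cvgB);
      by (exact: cvg_id || exact: cvg_cst).
  apply: cvgM; first exact: cvg_cst.
  by apply: cvgM => //; apply: cvgB => //; exact: cvg_cst.
have [c c01 gmax] := EVT_max ler01 cg.
suff g0 : g c <= 0.
  have := gmax s; rewrite in_itv /= => /(_ s01) gs.
  have : g s <= 0 by apply: le_trans g0.
  rewrite /g => H. nra.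
have [->|c0] := eqVneq c 0; first by rewrite /g; lra.
have [->|c1] := eqVneq c 1; first by rewrite /g; lra.
have {c0 c1 c01} /andP[c0 c1] : 0 < c < 1.
  by move: c01; rewrite in_itv /= !lt_neqAle eq_sym c0 c1.
exfalso.
have hnear : \forall h \near (0:R)^'+, [/\ 0 < h, h <= c, h <= 1 - c &
   2 * f c - e * h ^+ 2 <= f (c + h) + f (c - h)].
  near=> h; split.
  - by near: h; exact: nbhs_right_gt.
  - by near: h; apply: nbhs_right_le.
  - by near: h; apply: nbhs_right_le; rewrite subr_gt0.
  - by near: h; exact: f2.
have [h [h0 hc h1c hf]] := filter_ex hnear.
have gp : g (c + h) <= g c by apply: gmax; rewrite in_itv /=; lra.
have gm : g (c - h) <= g c by apply: gmax; rewrite in_itv /=; lra.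
have : 0 < e * h ^+ 2 by rewrite mulr_gt0 ?exprn_gt0.
have : g (c + h) + g (c - h) - 2 * g c
  = f (c + h) + f (c - h) - 2 * f c + 2 * (e * h ^+ 2) by rewrite /g; ring.
lra.
Unshelve. all: by end_near.
Qed.
End analysis.

(** * Entrywise multipliers and unitarily invariant norms *)

Section multipliers.
Import numFieldTopology.Exports numFieldNormedType.Exports.
Local Open Scope classical_set_scope.
Local Open Scope sesquilinear_scope.
Variables (R : realType) (n : nat) (N : 'M[R[i]]_n -> R).
Hypothesis Nnorm : is_mxnorm N.

Lemma mxnorm0 : N 0 = 0.
Proof.
apply: complexI; have := mxnormZ Nnorm 0 0.
by rewrite scaler0 normr0 mul0r.
Qed.

Lemma mxnormZr (a : R) A : N (a%:C *: A) = `|a| * N A.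
Proof.
apply: complexI; rewrite (mxnormZ Nnorm) rmorphM; congr (_ * _).
by rewrite normc_def /= expr0n /= addr0 sqrtr_sqr.
Qed.

Lemma mxnormN A : N (- A) = N A.
Proof.
rewrite -[RHS]mul1r -(normr1 R) -normrN -mxnormZr.
by rewrite rmorphN rmorph1 scaleN1r.
Qed.

Lemma mxnorm_dist A B : `|N A - N B| <= N (A - B).
Proof.
have le C D : N C - N D <= N (C - D).
  by rewrite lerBlDr -{1}(subrK D C) (mxnormD Nnorm).
by rewrite ler_norml le andbT lerNl opprB -[leRHS]mxnormN opprB.
Qed.

Lemma mxnorm_sum (I : Type) (s : seq I) (P : pred I) (F : I -> 'M[R[i]]_n) :
  N (\sum_(i <- s | P i) F i) <= \sum_(i <- s | P i) N (F i).
Proof.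
elim/big_rec2: _ => [|i a A _ h]; first by rewrite mxnorm0.
by apply: le_trans (mxnormD Nnorm _ _) _; rewrite lerD2l.
Qed.

(** The Hadamard product with a real multiplier.  A function [g] of the left
    multiplication by [diag a] and the right multiplication by [diag b], which
    commute, is the multiplier [g (a i) (b j)]. *)
Definition schur (k : 'I_n -> 'I_n -> R) (Z : 'M[R[i]]_n) : 'M[R[i]]_n :=
  \matrix_(i, j) ((k i j)%:C * Z i j).

Lemma mxnorm_schur_le k Z :
  N (schur k Z) <= \sum_i \sum_j `|k i j| * N (Z i j *: delta_mx i j).
Proof.
rewrite [schur k Z]matrix_sum_delta; apply: le_trans (mxnorm_sum _ _ _) _.
apply: ler_sum => i _; apply: le_trans (mxnorm_sum _ _ _) _.
by apply: ler_sum => j _; rewrite mxE -scalerA mxnormZr.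
Qed.

(** Convergence of the entries entails convergence in norm, since the
    elementary matrices form a finite family. *)
Lemma mxnorm_schur_cvg0 (T : Type) (F : set_system T) (FF : Filter F)
    (k : T -> 'I_n -> 'I_n -> R) Z :
  (forall i j, k s i j @[s --> F] --> 0) -> N (schur (k s) Z) @[s --> F] --> 0.
Proof.
move=> k0.
pose b (s : T) := \sum_i \sum_j `|k s i j| * N (Z i j *: delta_mx i j).
have b0 : b s @[s --> F] --> 0.
  have -> : 0 = \sum_(i < n) \sum_(j < n)
      `|0 : R| * N (Z i j *: delta_mx i j) :> R.
    by rewrite !big1// => i _; rewrite big1// => j _; rewrite normr0 mul0r.
  apply: cvg_big => [|i _]; first exact: add_continuous.
  apply: cvg_big => [|j _]; first exact: add_continuous.
  by apply: cvgM; [exact: cvg_norm|exact: cvg_cst].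
apply: squeeze_cvgr (cvg_cst 0) b0.
by apply: nearW => s; rewrite mxnorm_schur_le (mxnorm_ge0 Nnorm).
Qed.

Lemma schurM k1 k2 Z :
  schur k1 (schur k2 Z) = schur (fun i j => k1 i j * k2 i j) Z.
Proof. by apply/matrixP => i j; rewrite !mxE rmorphM mulrA. Qed.

Lemma diag_mx_unitary (d : 'rV[R[i]]_n) :
  (forall i, d 0 i * (d 0 i)^* = 1) -> diag_mx d \is unitarymx.
Proof.
move=> d1; apply/unitarymxP; apply/matrixP => i j.
rewrite !mxE (bigD1 i)//= big1 => [|k ki]; last first.
  by rewrite !mxE (negbTE (_ : i != k)) ?mulr0n ?mul0r// eq_sym.
rewrite !mxE eqxx mulr1n addr0 eq_sym.
case: eqVneq => [->|_]; first by rewrite !mulr1n d1.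
by rewrite !mulr0n rmorph0 mulr0.
Qed.

Hypothesis Ninv : unitarily_invariant N.

Lemma mxnorm_diag_conj (u v : 'I_n -> R[i]) (Z : 'M[R[i]]_n) :
  (forall i, u i * (u i)^* = 1) -> (forall j, v j * (v j)^* = 1) ->
  N (\matrix_(i, j) (u i * Z i j * v j)) = N Z.
Proof.
move=> u1 v1; pose dg (w : 'I_n -> R[i]) := diag_mx (\row_i w i).
rewrite -(@Ninv Z (dg u) (dg v)); first congr N.
- by apply/matrixP => i j; rewrite mul_mx_diag mul_diag_mx !mxE.
- by apply: diag_mx_unitary => i; rewrite !mxE.
- by apply: diag_mx_unitary => i; rewrite !mxE.
Qed.

(** [2 cos (x - y) = e^(i x) e^(-i y) + e^(-i x) e^(i y)], and each term acts by
    unitary diagonal matrices on both sides. *)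
Lemma mxnorm_schur_cos (x y : 'I_n -> R) (Z : 'M[R[i]]_n) :
  N (schur (fun i j => cos (x i - y j)) Z) <= N Z.
Proof.
pose e (t : R) : R[i] := cos t +i* sin t.
have e1 t : e t * (e t)^* = 1.
  rewrite /e; simpc; rewrite -!expr2 cos2Dsin2.
  by congr (_ +i* _); ring.
pose E (s : R) := \matrix_(i, j) (e (s * x i) * Z i j * e (- s * y j)).
have NE s : N (E s) = N Z by apply: mxnorm_diag_conj.
have -> : schur (fun i j => cos (x i - y j)) Z = (2^-1)%:C *: (E 1 + E (-1)).
  apply/matrixP => i j; rewrite !mxE !mulN1r opprK !mul1r /e cosN sinN cosB.
  case: (Z i j) => a b; rewrite !cosN !sinN; simpc.
  by congr (_ +i* _); field.
rewrite mxnormZr ger0_norm ?invr_ge0//.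
apply: le_trans (_ : 2^-1 * (N (E 1) + N (E (-1))) <= _).
  by rewrite ler_wpM2l ?invr_ge0// (mxnormD Nnorm).
by rewrite !NE; lra.
Qed.

(** Compressing to the rows in [P] and the columns in [Q] multiplies by a
    diagonal projection on each side, and a diagonal projection is the
    average of the identity and of a diagonal matrix of signs. *)
Lemma mxnorm_schur_proj (P Q : pred 'I_n) (Z : 'M[R[i]]_n) :
  N (schur (fun i j => (P i)%:R * (Q j)%:R) Z) <= N Z.
Proof.
pose sg (b : bool) : R[i] := if b then 1 else -1.
have sg1 b : sg b * (sg b)^* = 1.
  by rewrite /sg; case: b; rewrite ?rmorphN rmorph1; ring.
pose E (u v : pred 'I_n) :=
  \matrix_(i, j) (sg (u i) * Z i j * sg (v j)).
have NE u v : N (E u v) = N Z by apply: mxnorm_diag_conj.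
have -> : schur (fun i j => (P i)%:R * (Q j)%:R) Z
    = (4^-1)%:C *: ((E P Q + E predT Q) + (E P predT + E predT predT)).
  apply/matrixP => i j; rewrite !mxE /sg.
  case: (Z i j) => a b; case: (P i); case: (Q j); simpc;
    by congr (_ +i* _); field.
rewrite mxnormZr ger0_norm ?invr_ge0//.
have D := mxnormD Nnorm.
have := D (E P Q + E predT Q) (E P predT + E predT predT).
have := D (E P Q) (E predT Q); have := D (E P predT) (E predT predT).
rewrite !NE; lra.
Qed.

Section three_lines.
Variables (x y : 'I_n -> R) (Z : 'M[R[i]]_n).

(** The function on the strip of the three lines theorem, along the real
    axis. *)
Definition strip (s : R) : 'M[R[i]]_n :=
  schur (fun i j => expR (s * x i + (1 - s) * y j)) Z.

Lemma strip_continuous : continuous (N \o strip).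
Proof.
move=> t; apply/cvgrPdist_le => e e0.
pose k (s : R) i j :=
  expR (t * x i + (1 - t) * y j) - expR (s * x i + (1 - s) * y j).
have kE s : strip t - strip s = schur (k s) Z.
  by apply/matrixP => i j; rewrite !mxE -mulrBl -rmorphB.
have k0 : N (schur (k s) Z) @[s --> t] --> 0.
  apply: mxnorm_schur_cvg0 => i j.
  rewrite -[X in _ --> X](subrr (expR (t * x i + (1 - t) * y j))).
  apply: cvgB; first exact: cvg_cst.
  apply: (cvg_comp _ expR) (@continuous_expR R _).
  apply: cvgD; apply: cvgM; try exact: cvg_cst; first exact: cvg_id.
  by apply: cvgB; [exact: cvg_cst|exact: cvg_id].
near=> s; apply: le_trans (_ : N (schur (k s) Z) <= _); last first.
  by near: s; exact: cvgr_le k0 _ e0.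
rewrite -kE; exact: mxnorm_dist.
Unshelve. all: by end_near.
Qed.

(** The sum over the fourth roots of unity [w] of the values at [s + w h] is
    [4 strip s] up to the multiplier [fourth_diff]; the two imaginary
    displacements contribute the multiplier [2 cos], which at most doubles the
    norm. *)
Lemma strip_second_difference (s e : R) : 0 < e ->
  \forall h \near 0^'+, 2 * N (strip s) - e * h ^+ 2
    <= N (strip (s + h)) + N (strip (s - h)).
Proof.
move=> e0; pose k (h : R) i j := fourth_diff (h * (x i - y j)) / h ^+ 2.
have k0 : N (schur (k h) (strip s)) @[h --> 0^'+] --> 0.
  apply: mxnorm_schur_cvg0 => i j; apply: cvg_dnbhs_at_right.
  exact: fourth_diff_littleo.
near=> h; have h0 : 0 < h by near: h; exact: nbhs_right_gt.
have ke : N (schur (k h) (strip s)) <= e by near: h; exact: cvgr_le k0 _ e0.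
pose C := schur (fun i j => cos (h * x i - h * y j)) (strip s).
have split4 : 4%:C *: strip s
    = strip (s + h) + strip (s - h) + 2%:C *: C
      - (h ^+ 2)%:C *: schur (k h) (strip s).
  apply/matrixP => i j; rewrite !mxE.
  have -> : cos (h * x i - h * y j) = cos (h * (x i - y j)) by rewrite mulrBr.
  have -> : expR ((s + h) * x i + (1 - (s + h)) * y j)
    = expR (s * x i + (1 - s) * y j) * expR (h * (x i - y j)).
    by rewrite -expRD; congr expR; ring.
  have -> : expR ((s - h) * x i + (1 - (s - h)) * y j)
    = expR (s * x i + (1 - s) * y j) * expR (- (h * (x i - y j))).
    by rewrite -expRD; congr expR; ring.
  have -> : k h i j = fourth_diff (h * (x i - y j)) / h ^+ 2 by [].
  rewrite /fourth_diff; set E := expR (s * _ + _); set c := cos _.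
  set e1 := expR _; set e2 := expR _; set z := Z i j.
  rewrite !mulrA -!rmorphM /= -!mulrDl -mulrBl -!rmorphD -rmorphB.
  congr (_%:C * _).
  by field; exact: lt0r_neq0.
have D := mxnormD Nnorm; have C1 := mxnorm_schur_cos
  (fun i => h * x i) (fun j => h * y j) (strip s).
have : N (4%:C *: strip s) <= N (strip (s + h)) + N (strip (s - h))
   + 2 * N C + h ^+ 2 * N (schur (k h) (strip s)).
  rewrite split4; apply: le_trans (D _ _) _; apply: lerD.
    apply: le_trans (D _ _) _; apply: lerD; first exact: D.
    by rewrite mxnormZr ger0_norm.
  by rewrite mxnormN mxnormZr ger0_norm ?sqr_ge0.
rewrite mxnormZr ger0_norm// -/C => H.
have : h ^+ 2 * N (schur (k h) (strip s)) <= e * h ^+ 2.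
  by rewrite mulrC ler_wpM2r ?sqr_ge0.
move: C1 H; rewrite -/C; lra.
Unshelve. all: by end_near.
Qed.
End three_lines.
End multipliers.

(** * The interpolation inequality *)

Section interpolation.
Local Open Scope sesquilinear_scope.
Variables (R : realType) (n : nat) (N : 'M[R[i]]_n -> R).
Hypothesis Nnorm : is_mxnorm N.
Hypothesis Ninv : unitarily_invariant N.

Lemma mxnorm_strip_chord (x y : 'I_n -> R) (Z : 'M[R[i]]_n) (s : R) :
  0 <= s <= 1 ->
  N (strip x y Z s) <= s * N (strip x y Z 1) + (1 - s) * N (strip x y Z 0).
Proof.
apply: (@chord_of_second_difference R (N \o strip x y Z)).
  exact: strip_continuous.
by move=> t e; exact: strip_second_difference.
Qed.

Lemma schur_expR_eq0 (k : 'I_n -> 'I_n -> R) (Z : 'M[R[i]]_n) :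
  schur (fun i j => expR (k i j)) Z = 0 -> Z = 0.
Proof.
move=> /matrixP Z0; apply/matrixP => i j; have /eqP := Z0 i j.
by rewrite !mxE mulf_eq0 eq_complex /= eqxx andbT gt_eqF ?expR_gt0//= => /eqP.
Qed.

(** Adding a constant [c] to [x] multiplies the norm at [s] by [e^(s c)]; the
    [c] for which the norms at 0 and at 1 agree turns the chord bound into the
    geometric mean. *)
Lemma mxnorm_schur_expR (x y : 'I_n -> R) (Z : 'M[R[i]]_n) (l u : R) :
  0 < l -> 0 < u -> l + u = 1 ->
  N (schur (fun i j => expR (l * x i + u * y j)) Z)
  <= N (schur (fun i j => expR (x i)) Z) `^ l
     * N (schur (fun i j => expR (y j)) Z) `^ u.
Proof.
move=> l0 u0 lu; have ul : u = 1 - l by rewrite -lu addrAC subrr add0r.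
set A := N (schur (fun i j => expR (x i)) Z).
set B := N (schur (fun i j => expR (y j)) Z).
have schur0 k : @schur R n k 0 = 0.
  by apply/matrixP => i j; rewrite !mxE mulr0.
have [A0|Apos] := eqVneq A 0.
  have -> : Z = 0 by apply: schur_expR_eq0 (mxnorm_eq0 Nnorm A0).
  by rewrite schur0 mxnorm0// mulr_ge0 ?powR_ge0.
have [B0|Bpos] := eqVneq B 0.
  have -> : Z = 0 by apply: schur_expR_eq0 (mxnorm_eq0 Nnorm B0).
  by rewrite schur0 mxnorm0// mulr_ge0 ?powR_ge0.
have {}Apos : 0 < A by rewrite lt_neqAle eq_sym Apos (mxnorm_ge0 Nnorm).
have {}Bpos : 0 < B by rewrite lt_neqAle eq_sym Bpos (mxnorm_ge0 Nnorm).
pose c := ln B - ln A.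
have := @mxnorm_strip_chord (fun i => x i + c) y Z l.
have stripE s : N (strip (fun i => x i + c) y Z s)
    = expR (s * c) * N (schur (fun i j => expR (s * x i + (1 - s) * y j)) Z).
  rewrite -[expR (s * c)]ger0_norm ?expR_ge0// -mxnormZr//.
  congr N; apply/matrixP => i j; rewrite !mxE mulrA -rmorphM -expRD.
  congr ((expR _)%:C * _).
  by ring.
rewrite (stripE l) (stripE 1) (stripE 0).
have -> : schur (fun i j => expR (1 * x i + (1 - 1) * y j)) Z
    = schur (fun i j => expR (x i)) Z.
  by apply/matrixP => i j; rewrite !mxE subrr mul0r addr0 mul1r.
have -> : schur (fun i j => expR (0 * x i + (1 - 0) * y j)) Z
    = schur (fun i j => expR (y j)) Z.
  by apply/matrixP => i j; rewrite !mxE subr0 mul0r add0r mul1r.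
rewrite -/A -/B -ul mul0r mul1r expR0 mul1r.
have -> : expR c * A = B.
  by rewrite /c expRB !lnK ?posrE// mulfVK// gt_eqF.
rewrite -mulrDl lu mul1r => /(_ _)/le_trans H.
rewrite /powR !gt_eqF// -expRD.
have -> : l * ln A + u * ln B = ln B - l * c by rewrite /c ul; ring.
rewrite expRB lnK ?posrE// ler_pdivlMr ?expR_gt0// mulrC.
apply: H => //; apply/andP; split; first exact: ltW.
by rewrite -lu lerDl ltW.
Qed.

(** The multiplier on the left vanishes where [a] or [b] does, so [Y] may be
    compressed to the remaining entries, where [ln] inverts [expR]; the
    compression can only decrease the norms on the right. *)
Lemma mxnorm_schur_powR (a b : 'I_n -> R) (Y : 'M[R[i]]_n) (l u : R) :
  (forall i, 0 <= a i) -> (forall j, 0 <= b j) ->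
  0 < l -> 0 < u -> l + u = 1 ->
  N (schur (fun i j => a i `^ l * b j `^ u) Y)
  <= N (schur (fun i j => a i) Y) `^ l * N (schur (fun i j => b j) Y) `^ u.
Proof.
move=> a0 b0 l0 u0 lu.
pose W := schur (fun i j => (a i != 0)%:R * (b j != 0)%:R) Y.
have := mxnorm_schur_expR (fun i => ln (a i)) (fun j => ln (b j)) W l0 u0 lu.
have expln (c : R) : 0 <= c -> expR (ln c) * (c != 0)%:R = c.
  move=> c0; have [->|cn0] := eqVneq c 0; first by rewrite mulr0.
  by rewrite mulr1 lnK// posrE lt_neqAle eq_sym cn0.
have Na : N (schur (fun i j => expR (ln (a i))) W)
    <= N (schur (fun i j => a i) Y).
  apply: le_trans (mxnorm_schur_proj Nnorm Ninv predT (fun j => b j != 0) _).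
  rewrite le_eqVlt; apply/orP; left; apply/eqP; congr N.
  rewrite /W !schurM; congr (schur _ _); apply/funext => i; apply/funext => j.
  by rewrite mulrA expln// mul1r mulrC.
have Nb : N (schur (fun i j => expR (ln (b j))) W)
    <= N (schur (fun i j => b j) Y).
  apply: le_trans (mxnorm_schur_proj Nnorm Ninv (fun i => a i != 0) predT _).
  rewrite le_eqVlt; apply/orP; left; apply/eqP; congr N.
  rewrite /W !schurM; congr (schur _ _); apply/funext => i; apply/funext => j.
  by rewrite mulrCA expln// mulr1.
have -> : schur (fun i j => expR (l * ln (a i) + u * ln (b j))) W
    = schur (fun i j => a i `^ l * b j `^ u) Y.
  rewrite /W schurM; congr (schur _ _); apply/funext => i; apply/funext => j.
  rewrite expRD mulrACA /powR.
  have hp (c v : R) : 0 < v ->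
      expR (v * ln c) * (c != 0)%:R
      = if c == 0 then (v == 0)%:R else expR (v * ln c).
    by move=> v0; case: eqVneq => _; rewrite ?mulr1// (gt_eqF v0) mulr0.
  by rewrite !hp.
move/le_trans; apply; apply: ler_pM; rewrite ?powR_ge0//.
  by rewrite ge0_ler_powR ?nnegrE ?(mxnorm_ge0 Nnorm)// ltW.
by rewrite ge0_ler_powR ?nnegrE ?(mxnorm_ge0 Nnorm)// ltW.
Qed.

(** The eigenvalue is the value of the quadratic form at the [i]-th vector of
    the diagonalizing orthonormal basis. *)
Lemma psdmx_spectral_diag_ge0 (A : 'M[R[i]]_n) (i : 'I_n) :
  psdmx A -> 0 <= spectral_diag A 0 i.
Proof.
move=> [Aherm Age0].
have /orthomx_spectralP AE := hermitian_normalmx Aherm.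
have PU := spectral_unitarymx A.
set P := spectralmx A in AE PU; have Pu : P \in unitmx := spectral_unit A.
pose v : 'cV[R[i]]_n := invmx P *m delta_mx i 0; have := Age0 v.
have -> : v ^t* = delta_mx 0 i *m P.
  by rewrite /v trmx_mul map_mxM trmx_delta map_delta_mx invmx_unitary// trmxCK.
have PAE : P *m A *m invmx P = diag_mx (spectral_diag A).
  by rewrite [X in P *m X]AE !mulmxA mulmxV// mul1mx mulmxK.
have -> : delta_mx (0 : 'I_1) i *m P *m A *m v
    = delta_mx 0 i *m (P *m A *m invmx P) *m delta_mx i 0.
  by rewrite /v !mulmxA.
by rewrite PAE -rowE -colE !mxE eqxx mulr1n.
Qed.

Definition spectral_re (A : 'M[R[i]]_n) (i : 'I_n) : R :=
  complex.Re (spectral_diag A 0 i).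

Lemma spectral_re_ge0 (A : 'M[R[i]]_n) (i : 'I_n) :
  psdmx A -> 0 <= spectral_re A i.
Proof. by move/psdmx_spectral_diag_ge0 => /(_ i); rewrite lecE => /andP[]. Qed.

Lemma psdmx_spectralE (A : 'M[R[i]]_n) :
  psdmx A ->
  A = invmx (spectralmx A) *m diag_mx (\row_i (spectral_re A i)%:C)
      *m spectralmx A.
Proof.
move=> Apsd; have /orthomx_spectralP AE := hermitian_normalmx Apsd.1.
have -> : \row_i (spectral_re A i)%:C = spectral_diag A; last exact: AE.
apply/rowP => i; rewrite mxE RRe_real// realE.
by rewrite (psdmx_spectral_diag_ge0 _ Apsd).
Qed.

Lemma mxpowRE (A : 'M[R[i]]_n) (s : R) :
  mxpowR A s = invmx (spectralmx A)
    *m diag_mx (\row_i (spectral_re A i `^ s)%:C) *m spectralmx A.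
Proof.
have -> : \row_i (spectral_re A i `^ s)%:C
    = map_mx (fun z : R[i] => (complex.Re z `^ s)%:C) (spectral_diag A).
  by apply/rowP => i; rewrite !mxE.
by [].
Qed.

Lemma mxnorm_unitary_conj (P Q D E X : 'M[R[i]]_n) :
  P \is unitarymx -> Q \is unitarymx ->
  N (invmx P *m D *m P *m X *m (invmx Q *m E *m Q))
  = N (D *m (P *m X *m invmx Q) *m E).
Proof.
move=> PU QU; have PV : invmx P \is unitarymx.
  by rewrite (invmx_unitary PU) trmxC_unitary; exact: PU.
rewrite -[RHS](Ninv _ PV QU); congr N.
by move: (invmx P) (invmx Q) => P' Q'; rewrite !mulmxA.
Qed.

(** In the eigenbases of [T] and [S], multiplying on the left by [T^l] and on
    the right by [S^u] is the multiplier [a i `^ l * b j `^ u]. *)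
Lemma mxnorm_mxpowR_le (T S X : 'M[R[i]]_n) (l u : R) :
  psdmx T -> psdmx S -> 0 < l -> 0 < u -> l + u = 1 ->
  N (mxpowR T l *m X *m mxpowR S u) <= N (T *m X) `^ l * N (X *m S) `^ u.
Proof.
move=> Tp Sp l0 u0 lu.
have TE := psdmx_spectralE Tp; have TlE := mxpowRE T l.
have SE := psdmx_spectralE Sp; have SuE := mxpowRE S u.
have a0 i := spectral_re_ge0 i Tp; have b0 i := spectral_re_ge0 i Sp.
have Pu := spectral_unitarymx T; have Qu := spectral_unitarymx S.
(* Only the diagonalizations matter from now on, not how they are chosen. *)
move: (spectralmx T) (spectralmx S) (spectral_re T) (spectral_re S)
  TE TlE SE SuE Pu Qu a0 b0 => P Q a b TE TlE SE SuE PU QU a0 b0.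
have Pu := unitarymx_unit PU; have Qu := unitarymx_unit QU.
pose Y := P *m X *m invmx Q.
have conj D E := mxnorm_unitary_conj D E X PU QU.
have -> : N (T *m X) = N (schur (fun i j => a i) Y).
  have := conj (diag_mx (\row_i (a i)%:C)) 1%:M.
  rewrite (mulmx1 (invmx Q)) (mulVmx Qu) -TE !mulmx1 => ->; congr N.
  by apply/matrixP => i j; rewrite mul_diag_mx !mxE.
have -> : N (X *m S) = N (schur (fun i j => b j) Y).
  have := conj 1%:M (diag_mx (\row_i (b i)%:C)).
  rewrite (mulmx1 (invmx P)) (mulVmx Pu) -SE !mul1mx => ->; congr N.
  by apply/matrixP => i j; rewrite mul_mx_diag !mxE mulrC.
have -> : N (mxpowR T l *m X *m mxpowR S u)
    = N (schur (fun i j => a i `^ l * b j `^ u) Y).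
  rewrite TlE SuE conj; congr N; apply/matrixP => i j.
  by rewrite mul_mx_diag mul_diag_mx !mxE rmorphM mulrAC.
exact: mxnorm_schur_powR.
Qed.
End interpolation.

(** * The theorem *)

Theorem theorem5p6 (R : realType) (n : nat) (T S X : 'M[R[i]]_n) (p q : R)
    (m : nat) (N : 'M[R[i]]_n -> R) :
  psdmx T -> psdmx S ->
  1 < p -> 1 < q -> 1 / p + 1 / q = 1 ->
  is_mxnorm N -> unitarily_invariant N ->
  forall r : R, 1 <= r ->
    let r0 := Num.min (1 / p) (1 / q) in
    N (mxpowR T (1 / p) *m X *m mxpowR S (1 / q)) ^+ m
      + r0 ^+ m * (N (T *m X) `^ (m%:R / 2) - N (X *m S) `^ (m%:R / 2)) ^+ 2
    <= (1 / p * N (T *m X) `^ r + 1 / q * N (X *m S) `^ r) `^ (m%:R / r).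
Proof.
move=> Tp Sp p1 q1 pq Nn Ni r r1; cbv zeta.
have l0 : 0 < 1 / p by rewrite divr_gt0// (lt_trans _ p1).
have u0 : 0 < 1 / q by rewrite divr_gt0// (lt_trans _ q1).
have N0 := mxnorm_ge0 Nn.
apply: (@le_trans _ _ ((1 / p * N (T *m X) + 1 / q * N (X *m S)) ^+ m)).
  apply: le_trans (refined_young m (N0 _) (N0 _) l0 u0 pq).
  rewrite lerD2r lerXn2r ?nnegrE ?N0 ?mulr_ge0 ?powR_ge0//.
  exact: mxnorm_mxpowR_le.
have mean_ge0 : 0 <= 1 / p * N (T *m X) + 1 / q * N (X *m S).
  by apply: addr_ge0; apply: mulr_ge0; rewrite ?N0 ?(ltW l0) ?(ltW u0).
rewrite (mulrC m%:R) powRrM -powR_mulrn//.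
apply: ge0_ler_powR; rewrite ?nnegrE ?powR_ge0//.
by apply: power_mean_le; rewrite ?N0 ?(ltW l0) ?(ltW u0).
Qed.
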